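(* Let $A$ be a PS domain. Then any flat $A$-module is a PS module over $A$.
   Context: All rings are commutative and unitary. For an integral domain $A$, a torsion-free $A$-module $M$ is a PS module (pre-Schreier module) if every equality $ax=by$ with $a,b\in A-\{0\}$ and $x,y\in M-\{0\}$ has a refinement, i.e. there exist $c,d,e\in A$ and $z\in M$ with $a=ce$, $b=cd$, $x=dz$, $y=ez$. $A$ is a PS domain (pre-Schreier domain) if it is a PS module over itself. *)

(* Defs.v *)
From HB Require Import structures.
From mathcomp Require Import all_boot all_order all_algebra.
From mathcomp Require Import generic_quotient ring_quotient.
From mathcomp Require Import boolp.
From mathcomp.multinomials Require Import freeg.

Set Implicit Arguments.
Unset Strict Implicit.
Unset Printing Implicit Defensive.

Import GRing.Theory.

Local Open Scope ring_scope.
Local Open Scope quotient_scope.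

Section Span.
Variables (R : nzRingType) (V : lmodType R) (P : V -> Prop).

Inductive in_span : V -> Prop :=
| in_span0 : in_span 0
| in_spanS a u v : P u -> in_span v -> in_span (a *: u + v).

Definition span : {pred V} := [pred v | `[< in_span v >]].

Lemma spanP v : reflect (in_span v) (v \in span).
Proof. exact: asboolP. Qed.

Lemma mem_span u : P u -> u \in span.
Proof.
by move=> Pu; apply/spanP; rewrite -[u]addr0 -[u]scale1r; apply: in_spanS in_span0.
Qed.

Lemma span_submod_closed : submod_closed span.
Proof.
split=> [|a u v /spanP u_in /spanP v_in]; apply/spanP; first exact: in_span0.
elim: u_in => [|b w {}u Pw _ IH]; first by rewrite scaler0 add0r.
by rewrite scalerDr scalerA -addrA; apply: in_spanS.
Qed.

HB.instance Definition _ :=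
  GRing.isSubmodClosed.Build R V span span_submod_closed.

End Span.

Section QuotientModule.
Variables (R : nzRingType) (V : lmodType R) (P : V -> Prop).

Local Notation S := (span P).

Definition modquot := Quotient.quot S.
HB.instance Definition _ := GRing.Zmodule.on modquot.

Definition modproj (v : V) : modquot := \pi_(Quotient.quot S) v.

Lemma modproj_eq u v : (modproj u == modproj v) = (u - v \in S).
Proof. by rewrite Quotient.idealrBE. Qed.

Lemma modproj_repr (q : modquot) : modproj (repr q) = q.
Proof. exact: reprK. Qed.

Lemma modprojB : zmod_morphism modproj.
Proof. exact: raddfB. Qed.

Definition modquot_scale (a : R) (q : modquot) := modproj (a *: repr q).

Lemma modquot_scaleE a v : modquot_scale a (modproj v) = modproj (a *: v).
Proof.
apply/eqP; rewrite modproj_eq -scalerBr rpredZ // -modproj_eq.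
by rewrite modproj_repr.
Qed.

Let modprojD u v : modproj (u + v) = modproj u + modproj v.
Proof. exact: raddfD. Qed.

Lemma modquot_scaleA a b q :
  modquot_scale a (modquot_scale b q) = modquot_scale (a * b) q.
Proof. by rewrite -[q]modproj_repr !modquot_scaleE scalerA. Qed.

Lemma modquot_scale1 : left_id 1 modquot_scale.
Proof. by move=> q; rewrite -[q]modproj_repr modquot_scaleE scale1r. Qed.

Lemma modquot_scaleDr : right_distributive modquot_scale +%R.
Proof.
move=> a p q; rewrite -[p]modproj_repr -[q]modproj_repr.
by rewrite -modprojD !modquot_scaleE scalerDr modprojD.
Qed.

Lemma modquot_scaleDl q : {morph modquot_scale^~ q : a b / a + b}.
Proof.
move=> a b; rewrite -[q]modproj_repr.
by rewrite !modquot_scaleE scalerDl modprojD.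
Qed.

HB.instance Definition _ := GRing.Zmodule_isLmodule.Build R modquot
  modquot_scaleA modquot_scale1 modquot_scaleDr modquot_scaleDl.

Lemma modproj_linear : linear modproj.
Proof. by move=> a u v; rewrite modprojD -modquot_scaleE. Qed.

HB.instance Definition _ :=
  GRing.isLinear.Build R V modquot *:%R modproj modproj_linear.

End QuotientModule.

Definition bilinear_map (A : comNzRingType) (N M T : lmodType A)
    (b : N -> M -> T) : Prop :=
  (forall y, linear (b^~ y)) /\ (forall x, linear (b x)).

(* N ⊗_A M is the free A-module on N * M modulo the submodule spanned by the
   bilinearity relators; tensor_lift_tens and tensor_lift_uniq give the
   universal property. *)
Section Tensor.
Variables (A : comNzRingType) (N M : lmodType A).

Local Notation F := {freeg (N * M)%type / A}.

Definition fgen (x : N) (y : M) : F := Freeg [:: (1, (x, y))].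

Variant tensor_relator : F -> Prop :=
| relator_addl x x' y : tensor_relator (fgen (x + x') y - fgen x y - fgen x' y)
| relator_addr x y y' : tensor_relator (fgen x (y + y') - fgen x y - fgen x y')
| relator_scalel a x y : tensor_relator (fgen (a *: x) y - a *: fgen x y)
| relator_scaler a x y : tensor_relator (fgen x (a *: y) - a *: fgen x y).

Definition tensor := modquot tensor_relator.
HB.instance Definition _ := GRing.Lmodule.on tensor.

Definition tens (x : N) (y : M) : tensor := modproj tensor_relator (fgen x y).

Lemma tensDl x x' y : tens (x + x') y = tens x y + tens x' y.
Proof.
rewrite /tens -raddfD; apply/eqP; rewrite modproj_eq mem_span // opprD addrA.
exact: relator_addl.
Qed.

Lemma tensDr x y y' : tens x (y + y') = tens x y + tens x y'.
Proof.
rewrite /tens -raddfD; apply/eqP; rewrite modproj_eq mem_span // opprD addrA.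
exact: relator_addr.
Qed.

Lemma tensZl a x y : tens (a *: x) y = a *: tens x y.
Proof.
rewrite /tens -linearZ; apply/eqP; rewrite modproj_eq mem_span //.
exact: relator_scalel.
Qed.

Lemma tensZr a x y : tens x (a *: y) = a *: tens x y.
Proof.
rewrite /tens -linearZ; apply/eqP; rewrite modproj_eq mem_span //.
exact: relator_scaler.
Qed.

Lemma tens_bilinear : bilinear_map tens.
Proof.
by split=> [y a x x' | x a y y']; rewrite (tensDl, tensDr) (tensZl, tensZr).
Qed.

Section Lift.
Variables (T : lmodType A) (b : N -> M -> T).

Definition free_lift (D : F) : T := fglift (fun p => b p.1 p.2) D.

Lemma free_lift_gen x y : free_lift (fgen x y) = b x y.
Proof. by rewrite /free_lift liftU scale1r. Qed.

Lemma free_lift_linear : linear free_lift.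
Proof.
have addL : zmod_morphism free_lift by exact: lift_is_additive.
pose L : {additive F -> T} := HB.pack free_lift
  (GRing.isZmodMorphism.Build _ _ free_lift addL).
have LZ a D : L (a *: D) = a *: L D.
  rewrite -{2}[D]freeg_sumE -[a *: D]/(fgscale a D) /fgscale !(raddf_sum L).
  rewrite scaler_sumr; apply: eq_bigr => p _.
  by rewrite /= /free_lift !liftU scalerA.
by move=> a D D'; rewrite -[LHS]/(L _) raddfD LZ.
Qed.

HB.instance Definition _ :=
  GRing.isLinear.Build A F T *:%R free_lift free_lift_linear.

(* Meaningful only for a bilinear b. *)
Definition tensor_lift (t : tensor) : T := free_lift (repr t).

Hypothesis b_bilin : bilinear_map b.

Lemma free_lift_span D : D \in span tensor_relator -> free_lift D = 0.
Proof.
have [bl br] := b_bilin.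
have bDl x x' y : b (x + x') y = b x y + b x' y.
  by have := bl y 1 x x'; rewrite !scale1r.
have bDr x y y' : b x (y + y') = b x y + b x y'.
  by have := br x 1 y y'; rewrite !scale1r.
have b0l y : b 0 y = 0.
  by apply: (addrI (b 0 y)); rewrite -bDl !addr0.
have b0r x : b x 0 = 0.
  by apply: (addrI (b x 0)); rewrite -bDr !addr0.
have bZl a x y : b (a *: x) y = a *: b x y.
  by have := bl y a x 0; rewrite !addr0 b0l addr0.
have bZr a x y : b x (a *: y) = a *: b x y.
  by have := br x a y 0; rewrite !addr0 b0r addr0.
have b_relator u : tensor_relator u -> free_lift u = 0.
  case=> [x x' y|x y y'|c x y|c x y].
  - by rewrite !linearB /= !free_lift_gen bDl -addrA -opprD subrr.
  - by rewrite !linearB /= !free_lift_gen bDr -addrA -opprD subrr.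
  - by rewrite linearB linearZ /= !free_lift_gen bZl subrr.
  - by rewrite linearB linearZ /= !free_lift_gen bZr subrr.
move=> /spanP; elim=> [|a u v Pu _ IH]; first exact: linear0.
by rewrite linearP /= IH addr0 b_relator // scaler0.
Qed.

Lemma tensor_lift_proj D :
  tensor_lift (modproj tensor_relator D) = free_lift D.
Proof.
apply/eqP; rewrite -subr_eq0 -linearB; apply/eqP/free_lift_span.
by rewrite -modproj_eq modproj_repr.
Qed.

Lemma tensor_lift_linear : linear tensor_lift.
Proof.
move=> a t t'; rewrite -[t]modproj_repr -[t']modproj_repr -linearP.
by rewrite !tensor_lift_proj linearP.
Qed.

Lemma tensor_lift_tens x y : tensor_lift (tens x y) = b x y.
Proof. by rewrite tensor_lift_proj free_lift_gen. Qed.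

Lemma tensor_lift_uniq (g : {linear tensor -> T}) :
  (forall x y, g (tens x y) = b x y) -> g =1 tensor_lift.
Proof.
move=> gE t; rewrite -[t]modproj_repr tensor_lift_proj; move: (repr t) => D.
rewrite -[D]freeg_sumE !linear_sum; apply: eq_bigr => -[x y] _.
set c := coeff _ _.
have -> : Freeg [:: (c, (x, y))] = c *: fgen x y.
  by apply/eqP/freeg_eqP => p; rewrite coeffZ !coeffU mul1r.
by rewrite !linearZ /= free_lift_gen -gE.
Qed.

End Lift.
End Tensor.

(* f ⊗ id_M *)
Definition tensor_map (A : comNzRingType) (N N' M : lmodType A)
    (f : {linear N -> N'}) : tensor N M -> tensor N' M :=
  tensor_lift (fun x y => tens (f x) y).
Arguments tensor_map {A N N'} M f _.

Section TensorMap.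
Variables (A : comNzRingType) (N N' M : lmodType A) (f : {linear N -> N'}).

Lemma tensor_map_bilinear : bilinear_map (fun x (y : M) => tens (f x) y).
Proof.
split=> [y a x x' | x a y y']; first by rewrite linearP tensDl tensZl.
by rewrite tensDr tensZr.
Qed.

Lemma tensor_map_linear : linear (tensor_map M f).
Proof. exact/tensor_lift_linear/tensor_map_bilinear. Qed.

HB.instance Definition _ := GRing.isLinear.Build A (tensor N M) (tensor N' M)
  *:%R (tensor_map M f) tensor_map_linear.

Lemma tensor_map_tens x y : tensor_map M f (tens x y) = tens (f x) y.
Proof. exact/tensor_lift_tens/tensor_map_bilinear. Qed.

End TensorMap.

Definition flat (A : comNzRingType) (M : lmodType A) : Prop :=
  forall (N N' : lmodType A) (f : {linear N -> N'}),
    injective f -> injective (tensor_map M f).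

Definition torsion_free (A : idomainType) (M : lmodType A) : Prop :=
  forall (a : A) (x : M), a *: x = 0 -> a = 0 \/ x = 0.

Definition ps_module (A : idomainType) (M : lmodType A) : Prop :=
  torsion_free M /\
  forall (a b : A) (x y : M),
    a != 0 -> b != 0 -> x != 0 -> y != 0 -> a *: x = b *: y ->
    exists (c d e : A) (z : M),
      [/\ a = c * e, b = c * d, x = d *: z & y = e *: z].

Definition ps_domain (A : idomainType) : Prop := ps_module A^o.

(* Main.v *)
Require Import Defs.
From mathcomp Require Import all_boot all_order all_algebra.
From HB Require Import structures.
From mathcomp Require Import generic_quotient.

(** A relation [a x = b y] in a flat module is a consequence of relations
    [a r = b s] holding in [A]: the module [A^2 / {(r, s) | a r = b s}] embeds
    in [A] by [(r, s) |-> a r - b s], flatness keeps this embedding injective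
    after tensoring with [M], and hence [(x, y)] is a sum of pairs
    [(r z, s z)].  Over a pre-Schreier domain such summands can be absorbed one
    at a time: once [a = c e], [b = c d], cancelling [c] turns [a r = b s] into
    [e r = d s], whose refinement also refines what was accumulated before. *)

Set Implicit Arguments.
Unset Strict Implicit.
Unset Printing Implicit Defensive.

Import GRing.Theory.
Local Open Scope ring_scope.

Section FlatRelation.
Variables (A : comNzRingType) (M : lmodType A) (a b : A).

Definition relation_form (p : A^o * A^o) : A^o := a * p.1 - b * p.2.

Lemma relation_form_linear : linear relation_form.
Proof.
move=> c p q; rewrite /relation_form /= !mulrDr opprD addrACA; congr (_ + _).
by rewrite /GRing.scale /= mulrBr !(mulrCA _ c).
Qed.

HB.instance Definition _ := GRing.isLinear.Build A (A^o * A^o)%type A^o *:%R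
  relation_form relation_form_linear.

Definition scalar_relation (p : A^o * A^o) : Prop := relation_form p = 0.

Definition pair_scale (p : A^o * A^o) (z : M) : M * M :=
  (p.1 *: z, p.2 *: z).

Lemma pair_scale_bilinear : bilinear_map pair_scale.
Proof.
split=> [z c p q | p c z z']; rewrite /pair_scale; congr pair => /=.
- by rewrite scalerDl -scalerA.
- by rewrite scalerDl -scalerA.
- by rewrite scalerDr !scalerA mulrC.
- by rewrite scalerDr !scalerA mulrC.
Qed.

Definition relation_multiple (w : M * M) : Prop :=
  exists p z, scalar_relation p /\ w = pair_scale p z.

Local Notation N := (modquot scalar_relation).
Local Notation T := (modquot relation_multiple).

(** The relations are the kernel of a linear form, so passing to the span adds nothing. *)
Lemma span_scalar_relation p :
  p \in Defs.span scalar_relation -> scalar_relation p.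
Proof.
move=> /spanP; elim=> [|c u v Pu _ Pv]; rewrite /scalar_relation.
  exact: linear0.
by rewrite linearP /= Pu Pv addr0 scaler0.
Qed.

Lemma repr_modproj_relation p :
  scalar_relation (repr (modproj scalar_relation p) - p).
Proof. by apply: span_scalar_relation; rewrite -modproj_eq modproj_repr. Qed.

Definition relation_embed (q : N) : A^o := relation_form (repr q).

Lemma relation_embedE p :
  relation_embed (modproj scalar_relation p) = relation_form p.
Proof.
by apply/eqP; rewrite -subr_eq0 -linearB; apply/eqP/repr_modproj_relation.
Qed.

Lemma relation_embed_linear : linear relation_embed.
Proof.
move=> c p q; rewrite -[p]modproj_repr -[q]modproj_repr -linearP.
by rewrite !relation_embedE linearP.
Qed.

HB.instance Definition _ := GRing.isLinear.Build A N A^o *:%R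
  relation_embed relation_embed_linear.

Lemma relation_embed_inj : injective relation_embed.
Proof.
move=> p q; rewrite -[p]modproj_repr -[q]modproj_repr !relation_embedE => pq.
by apply/eqP; rewrite modproj_eq mem_span // /scalar_relation linearB /= pq subrr.
Qed.

(** Changing the representative of [q] moves the pair by a relation multiple, which is zero in [T];
    this makes the pairing descend to [N]. *)
Definition quot_pair_scale (q : N) (z : M) : T :=
  modproj relation_multiple (pair_scale (repr q) z).

Lemma quot_pair_scaleE p z :
  quot_pair_scale (modproj scalar_relation p) z =
  modproj relation_multiple (pair_scale p z).
Proof.
apply/eqP; rewrite modproj_eq mem_span //.
exists (repr (modproj scalar_relation p) - p), z; split.
  exact: repr_modproj_relation.
by rewrite /pair_scale /= !scalerBl.
Qed.

Lemma quot_pair_scale_bilinear : bilinear_map quot_pair_scale.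
Proof.
have [bl br] := pair_scale_bilinear.
split=> [z c p q | p c z z'].
  rewrite -[p]modproj_repr -[q]modproj_repr -linearP !quot_pair_scaleE.
  by rewrite bl linearP.
by rewrite /quot_pair_scale br linearP.
Qed.

Lemma flat_relation_span x y : flat M -> a *: x = b *: y ->
  in_span relation_multiple (x, y).
Proof.
move=> flatM axby; apply/spanP.
(* The pairing [quot_pair_scale] sends [t] to the class of [(x, y)] in [T], so [t = 0] puts [(x, y)]
   in the span. *)
pose t : tensor N M := tens (modproj scalar_relation (1, 0)) x
                     + tens (modproj scalar_relation (0, 1)) y.
have t0 : t = 0.
  apply: (flatM _ _ relation_embed relation_embed_inj).
  rewrite linear0 linearD /= !tensor_map_tens /= !relation_embedE.
  rewrite /relation_form /= !mulr1 !mulr0 subr0 sub0r.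
  (* The image of [t] is [a ⊗ x + (- b) ⊗ y]; writing scalars as multiples of [1] lets them cross to
     the right factor, giving [1 ⊗ (a x - b y)]. *)
  have scal (c : A) : (c : A^o) = c *: (1 : A^o) by rewrite /GRing.scale /= mulr1.
  rewrite [a in LHS]scal [- b]scal !tensZl -!tensZr axby -tensDr.
  by rewrite scaleNr subrr -(scale0r (0 : M)) tensZr scale0r.
have := tensor_lift_tens quot_pair_scale_bilinear.
pose L : {linear tensor N M -> T} := HB.pack (tensor_lift quot_pair_scale)
  (GRing.isLinear.Build A _ _ *:%R (tensor_lift quot_pair_scale)
    (tensor_lift_linear quot_pair_scale_bilinear)).
move=> LE; have : L t = 0 by rewrite t0 linear0.
rewrite linearD /= !LE !quot_pair_scaleE -linearD.
rewrite /pair_scale /= !scale1r !scale0r => /eqP.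
rewrite -(linear0 (modproj relation_multiple)) modproj_eq subr0.
by rewrite -[_ + _]/(x + 0, 0 + y) addr0 add0r.
Qed.

End FlatRelation.

(** Apply the span result to [a x = 0 y] with [y = 0]: for [a] nonzero, [a r = 0] forces [r = 0], so
    every pair in the span has first component zero. *)
Lemma flat_torsion_free (A : idomainType) (M : lmodType A) :
  flat M -> torsion_free M.
Proof.
move=> flatM a x ax0; have [->|a0] := eqVneq a 0; [by left | right].
have : in_span (relation_multiple a 0) (x, 0).
  by apply: flat_relation_span => //; rewrite ax0 scale0r.
rewrite -[x = 0]/((x, 0 : M).1 = 0).
elim=> [//|c _ v [[r s]] [z] [rel ->] _ /= ->].
move: rel; rewrite /scalar_relation /relation_form /= mul0r subr0 => /eqP.
by rewrite mulf_eq0 (negPf a0) => /eqP->; rewrite scale0r scaler0 addr0.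
Qed.

(** The coefficients of a relation in the span may vanish, so the refinement is extended to [r] or
    [s] zero; each then forces the other to be zero. *)
Lemma ps_domain_refine (A : idomainType) (a b r s : A) :
  ps_domain A -> a != 0 -> b != 0 -> a * r = b * s ->
  exists c d e t, [/\ a = c * e, b = c * d, r = d * t & s = e * t].
Proof.
move=> [_ ref] a0 b0 arbs; have [r0|r0] := eqVneq r 0.
  move/esym/eqP: arbs; rewrite r0 mulr0 mulf_eq0 (negPf b0) => /eqP ->.
  by exists 1, b, a, 0; rewrite !mul1r !mulr0.
apply: ref => //; apply: contraNneq a0 => s0.
by move/eqP: arbs; rewrite s0 mulr0 mulf_eq0 (negPf r0) orbF.
Qed.

Lemma in_span_relation_refine (A : idomainType) (M : lmodType A) (a b : A)
    (w : M * M) :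
  ps_domain A -> a != 0 -> b != 0 -> in_span (relation_multiple a b) w ->
  exists c d e (z : M), [/\ a = c * e, b = c * d, w.1 = d *: z & w.2 = e *: z].
Proof.
move=> psA a0 b0; elim=> [|k _ v [[r s]] [z0] [rel ->] _ [c [d [e [z]]]]].
  by exists 1, b, a, 0; rewrite !mul1r !scaler0.
move=> [ace bcd v1 v2].
move: a0 b0; rewrite ace mulf_eq0 negb_or => /andP[c0 e0].
rewrite bcd mulf_eq0 negb_or => /andP[_ d0].
have erds : e * r = d * s.
  apply: (mulfI c0); rewrite !mulrA -ace -bcd.
  by apply/eqP; rewrite -subr_eq0; apply/eqP.
have [c' [d' [e' [t [ee dd rr ss]]]]] := ps_domain_refine psA e0 d0 erds.
(* With [d = c' d'] and [r = d' t], the new first component [k r z0 + d z] factors as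
   [d' (k t z0 + c' z)]; likewise the second, with [e']. *)
exists (c * c'), d', e', ((k * t) *: z0 + c' *: z); split.
- by rewrite ee mulrA.
- by rewrite dd mulrA.
- by rewrite /= v1 rr dd scalerDr !scalerA mulrCA [c' * _]mulrC.
- by rewrite /= v2 ss ee scalerDr !scalerA mulrCA [c' * _]mulrC.
Qed.

Theorem corollary4p5 (A : idomainType) (M : lmodType A)
  (psA : ps_domain A) (flatM : flat M) : ps_module M.
Proof.
split=> [|a b x y a0 b0 _ _ axby]; first exact: flat_torsion_free.
exact: (in_span_relation_refine psA a0 b0 (flat_relation_span flatM axby)).
Qed.
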